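(* Let $\mathcal{H}$ be a complex Hilbert space, let $A\in\mathcal{B}(\mathcal{H})$ be positive semidefinite, and let $T\in\mathcal{B}_A(\mathcal{H})$. Then (i) $dw_A^2(T)\le \left\|\,|T|_A^2+(|T|_A^2)^{\sharp_A}|T|_A^2\right\|_A$; (ii) $dw_A^2(T)\le \frac12\left(w_A(T^2)+\|T\|_A^2\right)+\|T\|_A^4$.
   Context: $\mathcal{B}(\mathcal{H})$ is the algebra of bounded linear operators on the complex Hilbert space $\mathcal{H}$. For a positive semidefinite $A\in\mathcal{B}(\mathcal{H})$, put $\langle x,y\rangle_A=\langle Ax,y\rangle$ and $\|x\|_A=\sqrt{\langle x,x\rangle_A}$. $\mathcal{B}_A(\mathcal{H})$ is the set of $T\in\mathcal{B}(\mathcal{H})$ admitting an $A$-adjoint, i.e. such that $AX=T^*A$ has a solution $X\in\mathcal{B}(\mathcal{H})$; then $T^{\sharp_A}$ denotes the unique solution with $\mathcal{R}(T^{\sharp_A})\subseteq\overline{\mathcal{R}(A)}$ ($\mathcal{R}$ denotes range). $\mathcal{B}_A(\mathcal{H})$ is an algebra closed under $\sharp_A$, and every $T\in\mathcal{B}_A(\mathcal{H})$ is $A$-bounded, i.e. $\|Tx\|_A\le c\|x\|_A$ for all $x$ and some $c>0$. Write $|T|_A^2=T^{\sharp_A}T$. For $A$-bounded $T$: $\|T\|_A=\sup\{\|Tx\|_A:\|x\|_A=1\}$, $w_A(T)=\sup\{|\langle Tx,x\rangle_A|:\|x\|_A=1\}$, and $dw_A(T)=\sup\{\sqrt{|\langle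 Tx,x\rangle_A|^2+\|Tx\|_A^4}:\|x\|_A=1\}$, where $x$ ranges over $\mathcal{H}$. $dw_A^2(T)$ means $(dw_A(T))^2$. *)

(* Defs.v *)
From HB Require Import structures.
From mathcomp Require Import all_boot all_order all_algebra.
From mathcomp Require Import sesquilinear complex.
From mathcomp Require Import boolp classical_sets reals topology normedtype.

Set Implicit Arguments.
Unset Strict Implicit.
Unset Printing Implicit Defensive.

Import Order.TTheory GRing.Theory Num.Theory.
Import numFieldNormedType.Exports.

Local Open Scope classical_set_scope.
Local Open Scope complex_scope.
Local Open Scope ring_scope.

(* Complex Hilbert spaces: the complex field is R[i] for R : realType, and
   [inner] is linear in its first argument and conjugate-linear in its second.
   The norm of a normed module over R[i] takes its values in R[i]. *)
HB.mixin Record isHilbert (R : realType) H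
    of CompleteNormedModule R[i] H := {
  inner : {dot H for @Num.conj R[i]};
  norm_innerE : forall x : H, `|x| ^+ 2 = inner x x
}.

#[short(type="hilbertType")]
HB.structure Definition Hilbert (R : realType) :=
  {H of CompleteNormedModule R[i] H & isHilbert R H}.

Section operators.
Context {R : realType} {H : hilbertType R}.
Implicit Types (A T S X : H -> H) (x y : H).

Definition bounded_operator T :=
  linear T /\ exists c : R, forall x, `|T x| <= c%:C * `|x|.

(* In R[i], 0 <= z means that z is real and nonnegative. *)
Definition positive_operator A :=
  bounded_operator A /\ forall x, 0 <= inner (A x) x.

Definition is_adjoint T S :=
  bounded_operator S /\ forall x y, inner (T x) y = inner x (S y).

(* The Hilbert space adjoint T^*; the default value is never reached when T is
   bounded. *)
Definition adjoint T : H -> H := xget (fun=> 0) (is_adjoint T).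

Definition is_A_adjoint A T X :=
  bounded_operator X /\ A \o X = adjoint T \o A.

Definition has_A_adjoint A T :=
  bounded_operator T /\ exists X, is_A_adjoint A T X.

(* The reduced solution of A X = T^* A; the default value is never reached when
   A is positive and T has an A-adjoint. *)
Definition sharp A T : H -> H :=
  xget (fun=> 0)
    [set X | is_A_adjoint A T X /\ range X `<=` closure (range A)].

Definition innerA A x y : R[i] := inner (A x) y.

(* innerA A x x is real and nonnegative when A is positive. *)
Definition seminormA A x : R := Num.sqrt (complex.Re (innerA A x x)).

Definition abs2A A T : H -> H := sharp A T \o T.

Definition unit_sphereA A : set H := [set x | seminormA A x = 1].

(* The sets below are bounded for A-bounded T. If A = 0 they are empty and
   their supremum is 0. *)
Definition opnormA A T : R :=
  sup [set seminormA A (T x) | x in unit_sphereA A].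

Definition numradA A T : R :=
  sup [set ComplexField.Normc.normc (innerA A (T x) x)
      | x in unit_sphereA A].

Definition dwA A T : R :=
  sup [set Num.sqrt (ComplexField.Normc.normc (innerA A (T x) x) ^+ 2
                     + seminormA A (T x) ^+ 4)
      | x in unit_sphereA A].

End operators.

(* Main.v *)
(* If |x|_A = 1 and S = T#T, then |Tx|_A^2 = <Sx,x>_A and S is A-selfadjoint.
   (i) Cauchy-Schwarz gives |<Tx,x>_A|^2 <= |Tx|_A^2 = <Sx,x>_A and
   |Tx|_A^4 <= |Sx|_A^2 = <S#Sx,x>_A; the sum is at most |(S + S#S)x|_A.
   (ii) Buzano's inequality 2|<a,x><x,b>| <= |<a,b>| + |a||b| with a = Tx and
   b = T#x bounds |<Tx,x>_A|^2 by half of |<T^2 x,x>_A| + |Tx|_A |T#x|_A.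
   Both parts need T^* and T# to exist, and operators with an A-adjoint to be
   A-bounded. *)
From mathcomp Require Import all_boot all_order all_algebra.
From mathcomp Require Import sesquilinear complex ring lra.
From mathcomp Require Import boolp classical_sets reals topology normedtype.
Require Import Defs.
Set Implicit Arguments.
Unset Strict Implicit.
Unset Printing Implicit Defensive.

Import Order.TTheory GRing.Theory Num.Theory.
Import numFieldNormedType.Exports.
Local Open Scope ring_scope.

(** * Scalars: quadratic inequalities, suprema and moduli *)

Section real_and_complex.
Local Open Scope classical_set_scope.
Local Open Scope complex_scope.
Context {R : realType}.
Local Notation normc := ComplexField.Normc.normc.

Lemma le_eps0 (a k : R) :
  0 <= k -> (forall e : R, 0 < e -> a <= k * e) -> a <= 0.
Proof.
move=> k0 h; rewrite leNgt; apply/negP => a0.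
(* This [e] keeps [k * e] at most [a / 2]; the [+ 1] covers [k = 0]. *)
have := h (a / (k + 1) / 2); rewrite !divr_gt0 ?ltr_wpDl// => /(_ isT).
have -> : k * (a / (k + 1) / 2) = a * (k / (k + 1)) / 2.
  by field; rewrite gt_eqF// ltr_wpDl.
have : k / (k + 1) <= 1 by rewrite ler_pdivrMr ?ltr_wpDl// mul1r; lra.
set q := k / _ => q1 ?; have : a * q <= a by rewrite ler_piMr// ltW.
lra.
Qed.

(** The quadratic is smallest at [t = - b / c]; for [c = 0] a nonzero linear term would make it
    negative somewhere. It yields Cauchy-Schwarz, and later the first-order condition at an
    approximate minimum. *)
Lemma discriminant_le (a b c : R) : 0 <= c ->
  (forall t, 0 <= a + 2 * t * b + t ^+ 2 * c) -> b ^+ 2 <= a * c.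
Proof.
move=> c0 quad; have [b0|b0] := eqVneq b 0.
  rewrite b0 expr0n mulr_ge0//.
  by have := quad 0; rewrite expr0n /= !(mulr0,mul0r) !addr0.
have a0 : 0 <= a by have := quad 0; rewrite expr0n /= !(mulr0,mul0r) !addr0.
move: c0; rewrite le_eqVlt => /predU1P[c0|c0].
  have := quad (- (a + 1) / b); rewrite -c0 mulr0 addr0.
  have -> : a + 2 * (- (a + 1) / b) * b = - a - 2 by field.
  by move=> ?; exfalso; lra.
have := quad (- b / c).
have -> : a + 2 * (- b / c) * b + (- b / c) ^+ 2 * c = (a * c - b ^+ 2) / c.
  by field; rewrite gt_eqF.
by rewrite pmulr_lge0 ?invr_gt0// subr_ge0.
Qed.

Lemma invS_lt (e : R) : 0 < e ->
  exists N, forall n, (N <= n)%N -> n.+1%:R^-1 < e.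
Proof.
move=> e0; exists (Num.bound e^-1) => n Nn.
rewrite -[e]invrK ltf_pV2 ?posrE ?invr_gt0//.
rewrite (lt_le_trans (archi_boundP _)) ?invr_ge0 ?(ltW e0)// ler_nat.
exact: leqW.
Qed.

(** Bernoulli's inequality, by induction on [n]; the term [n%:R * d * d] is dropped. *)
Lemma exprn_ge_1D (d : R) n : 0 <= d -> 1 + n%:R * d <= (1 + d) ^+ n.
Proof.
move=> d0; elim: n => [|n IH]; first by rewrite mul0r addr0 expr0.
rewrite exprS; have : (1 + d) * (1 + n%:R * d) <= (1 + d) * (1 + d) ^+ n.
  by rewrite ler_wpM2l// addr_ge0.
apply: le_trans; rewrite -natr1; have : 0 <= n%:R * d * d by rewrite !mulr_ge0.
move: (n%:R : R) => k; lra.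
Qed.

(** If [E] has no supremum, [sup E] is the default value 0; otherwise it lies above some element of
    [E]. *)
Lemma sup_nonneg_ge0 (E : set R) : (forall r, E r -> 0 <= r) -> 0 <= sup E.
Proof.
move=> E0; have [hE|/sup_out->//] := pselect (has_sup E).
have [[r Er] _] := hE; rewrite (le_trans (E0 _ Er))//.
exact: (ub_le_sup hE.2).
Qed.

Lemma normc_ge0 (z : R[i]) : 0 <= normc z.
Proof. by case: z => u v; exact: sqrtr_ge0. Qed.

Lemma ReD (a b : R[i]) : complex.Re (a + b) = complex.Re a + complex.Re b.
Proof. by case: a; case: b. Qed.

Lemma ReZ (r : R) (a : R[i]) : complex.Re (r%:C * a) = r * complex.Re a.
Proof. by case: a => u v /=; rewrite mul0r subr0. Qed.

Lemma normcZ (r : R) (a : R[i]) :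
  normc (r%:C * a) = `|r| * normc a.
Proof. by rewrite ComplexField.Normc.normcM /= expr0n addr0 sqrtr_sqr. Qed.

(** For nonzero [z] the unit scalar [u = z^* / normc z] makes [u * z] equal to [normc z]. Bounds on
    moduli thus reduce to bounds on real parts. *)
Lemma normc_le (z : R[i]) (B : R) :
  (forall u, normc u = 1 -> complex.Re (u * z) <= B) ->
  normc z <= B.
Proof.
have [-> h|z0 h] := eqVneq z 0.
  have := h 1 (ComplexField.Normc.normc1 _).
  by rewrite mulr0 ComplexField.Normc.normc0.
have nz : normc z != 0.
  by apply: contra_neq z0 => /ComplexField.Normc.eq0_normc.
have := h ((normc z)^-1%:C * z^*).
rewrite normcZ.
have -> : normc z^* = normc z.
  by case: z {h z0 nz} => a b /=; rewrite sqrrN.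
rewrite ger0_norm ?invr_ge0 ?normc_ge0// mulVf// => /(_ erefl).
rewrite -mulrA ReZ.
have -> : complex.Re (z^* * z) = normc z ^+ 2.
  by case: z {h z0 nz} => a b /=; rewrite sqr_sqrtr ?addr_ge0 ?sqr_ge0//; ring.
by rewrite expr2 mulKf.
Qed.

End real_and_complex.

(** * Rules for the inner product and for linear maps *)

Section hilbert.
Local Open Scope classical_set_scope.
Local Open Scope complex_scope.
Context {R : realType} {H : hilbertType R}.
Implicit Types (A T S X : H -> H) (x y : H).
Local Notation normc := ComplexField.Normc.normc.

Lemma innerC x y : inner x y = (inner y x)^*.
Proof. by rewrite hermC expr0 mul1r. Qed.
Lemma innerDl x y z : inner (x + y) z = inner x z + inner y z.
Proof. exact: linearDl. Qed.
Lemma innerDr x y z : inner x (y + z) = inner x y + inner x z.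
Proof. exact: linearDr. Qed.
Lemma innerZl a x y : inner (a *: x) y = a * inner x y.
Proof. exact: linearZl_LR. Qed.
Lemma innerZr a x y : inner x (a *: y) = a^* * inner x y.
Proof. exact: linearZr_LR. Qed.
Lemma inner_ge0 x : 0 <= inner x x.
Proof. exact: dnorm_ge0. Qed.

Lemma lin_sub T x y : linear T -> T (x - y) = T x - T y.
Proof. by move=> lT; rewrite addrC -scaleN1r lT scaleN1r addrC. Qed.

Lemma lin_add T x y : linear T -> T (x + y) = T x + T y.
Proof. by move=> lT; have := lT 1 x y; rewrite !scale1r. Qed.

Lemma lin_zero T : linear T -> T 0 = 0.
Proof. by move=> lT; have := lin_sub 0 0 lT; rewrite !subrr. Qed.

Lemma lin_scale T a x : linear T -> T (a *: x) = a *: T x.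
Proof. by move=> lT; rewrite -[a *: x]addr0 lT lin_zero// addr0. Qed.

(** For positive [A] this is a symmetric real bilinear form, so that quadratic estimates become real
    arithmetic. *)
Definition reA A x y : R := complex.Re (innerA A x y).

Lemma positive_linear A : positive_operator A -> linear A.
Proof. by case=> -[]. Qed.

(** * The semi-inner product of a positive operator *)

Section positive.
Variables (A : H -> H) (pA : positive_operator A).
Let lA := positive_linear pA.

Lemma innerA_ge0 x : 0 <= innerA A x x. Proof. exact: pA.2. Qed.
Lemma innerADl x y z : innerA A (x + y) z = innerA A x z + innerA A y z.
Proof. by rewrite /innerA lin_add// innerDl. Qed.
Lemma innerADr x y z : innerA A x (y + z) = innerA A x y + innerA A x z.
Proof. exact: innerDr. Qed.
Lemma innerAZl a x y : innerA A (a *: x) y = a * innerA A x y.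
Proof. by rewrite /innerA lin_scale// innerZl. Qed.
Lemma innerAZr a x y : innerA A x (a *: y) = a^* * innerA A x y.
Proof. exact: innerZr. Qed.

(** Polarization: the form is real on the diagonal at [x], [y], [x + y] and [x + 'i *: y], and the
    vanishing imaginary parts give the two real equations. *)
Lemma innerAC x y : innerA A x y = (innerA A y x)^*.
Proof.
have im z : complex.Im (innerA A z z) = 0 by exact/ger0_Im/innerA_ge0.
have := im (x + y); have := im (x + 'i *: y).
rewrite !(innerADl, innerADr, innerAZl, innerAZr).
move: (im x) (im y).
case: (innerA A x x) => a b /= ->; case: (innerA A y y) => c d /= ->.
case: (innerA A x y) => e f; case: (innerA A y x) => g h /= h1 h2.
by congr Complex; lra.
Qed.

Lemma reAC x y : reA A x y = reA A y x.
Proof. by rewrite /reA innerAC; case: (innerA A y x). Qed.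

Lemma reADl x y z : reA A (x + y) z = reA A x z + reA A y z.
Proof. by rewrite /reA innerADl ReD. Qed.
Lemma reADr x y z : reA A x (y + z) = reA A x y + reA A x z.
Proof. by rewrite /reA innerADr ReD. Qed.
Lemma reAZl (r : R) x y : reA A (r%:C *: x) y = r * reA A x y.
Proof. by rewrite /reA innerAZl ReZ. Qed.
Lemma reAZr (r : R) x y : reA A x (r%:C *: y) = r * reA A x y.
Proof. by rewrite reAC reAZl reAC. Qed.
Lemma reAx_ge0 x : 0 <= reA A x x.
Proof.
have := innerA_ge0 x; rewrite /reA; case: innerA => a b.
by rewrite lecE /= => /andP[].
Qed.

Lemma innerAE x : innerA A x x = (reA A x x)%:C.
Proof.
have := innerA_ge0 x; rewrite /reA; case: innerA => a b.
by rewrite lecE /= => /andP[/eqP->].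
Qed.

Lemma seminormA_ge0 x : 0 <= seminormA A x. Proof. exact: sqrtr_ge0. Qed.

Lemma sqr_seminormA x : seminormA A x ^+ 2 = reA A x x.
Proof. by rewrite sqr_sqrtr ?reAx_ge0. Qed.

Lemma CauchySchwarz_reA x y : reA A x y <= seminormA A x * seminormA A y.
Proof.
have s0 : 0 <= seminormA A x * seminormA A y by rewrite mulr_ge0 ?seminormA_ge0.
have [/ltW p0|le0] := ltP 0 (reA A x y); last exact: le_trans s0.
rewrite -(@ler_pXn2r _ 2)// exprMn !sqr_seminormA.
(* The quadratic in [t] is the squared seminorm of [x + t%:C *: y]. *)
apply: discriminant_le => [|t]; first exact: reAx_ge0.
have := reAx_ge0 (x + t%:C *: y).
rewrite !(reADl, reADr, reAZl, reAZr) (reAC y x); lra.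
Qed.

Lemma seminormA_triangle x y :
  seminormA A (x + y) <= seminormA A x + seminormA A y.
Proof.
rewrite -(@ler_pXn2r _ 2)// ?nnegrE ?addr_ge0 ?seminormA_ge0//.
rewrite sqrrD !sqr_seminormA !(reADl, reADr) (reAC y x).
have := CauchySchwarz_reA x y; lra.
Qed.

Lemma seminormAZ a x : seminormA A (a *: x) = normc a * seminormA A x.
Proof.
apply/eqP; rewrite -(@eqrXn2 _ 2)// ?mulr_ge0 ?normc_ge0 ?seminormA_ge0//.
rewrite exprMn !sqr_seminormA /reA innerAZl innerAZr mulrA -sqr_normc.
by rewrite innerAE [`|a|](_ : _ = (normc a)%:C) // -rmorphXn ReZ.
Qed.

Lemma seminormAZr (r : R) x : seminormA A (r%:C *: x) = `|r| * seminormA A x.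
Proof. by rewrite seminormAZ /= expr0n addr0 sqrtr_sqr. Qed.

(** A unit scalar [u] can be absorbed into [x] without changing its seminorm, so the bound on real
    parts also bounds the modulus. *)
Lemma CauchySchwarz_normc x y :
  normc (innerA A x y) <= seminormA A x * seminormA A y.
Proof.
apply: normc_le => u u1; rewrite -innerAZl.
by rewrite (le_trans (CauchySchwarz_reA _ _))// seminormAZ u1 mul1r.
Qed.

End positive.

(** * The Hilbert norm as the case [A = id], and closures *)

Lemma bounded_id : bounded_operator (@id H).
Proof. by split=> //; exists 1 => x; rewrite mul1r. Qed.

Lemma positive_id : positive_operator (@id H).
Proof. by split; [exact: bounded_id|exact: inner_ge0]. Qed.

Local Notation re := (reA (@id H)).
Local Notation nrm := (seminormA (@id H)).
Let pid := positive_id.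

Lemma normE x : `|x| = (seminormA id x)%:C.
Proof.
apply/eqP; rewrite -(@eqrXn2 _ 2)// ?normr_ge0 ?ler0c ?seminormA_ge0//.
rewrite norm_innerE -[inner x x]/(innerA id x x) (innerAE pid).
by rewrite -rmorphXn (sqr_seminormA pid).
Qed.

Lemma boundedP T : linear T ->
  bounded_operator T <-> exists c : R, forall x, nrm (T x) <= c * nrm x.
Proof.
move=> lT; split=> [[_ [c h]]|[c h]]; last split=> //.
  by exists c => x; have := h x; rewrite !normE -rmorphM lecR.
by exists c => x; rewrite !normE -rmorphM lecR; exact: h.
Qed.

Lemma closureP (M : set H) z :
  closure M z <-> forall e : R, 0 < e -> exists2 m, M m & nrm (z - m) < e.
Proof.
split=> [cz e e0|h B /nbhs_normP[e /= e0 eB]].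
  have : nbhs z (ball z e%:C) by apply: nbhsx_ballx; rewrite ltcR.
  move=> /cz[m [Mm]]; rewrite -ball_normE /= normE ltcR => ?.
  by exists m.
have er : e = (complex.Re e)%:C by rewrite RRe_real// gtr0_real.
have [|m Mm zm] := h (complex.Re e); first by rewrite -ltcR -er.
by exists m; split=> //; apply: eB; rewrite /= normE er ltcR.
Qed.

Lemma scaleCN1 x : - x = (-1)%:C *: x.
Proof. by rewrite -scaleN1r; congr (_ *: _); congr Complex; rewrite oppr0. Qed.

Lemma reN x y : re (- x) y = - re x y.
Proof. by rewrite scaleCN1 (reAZl pid) mulN1r. Qed.

Lemma reB x y z : re (x - y) z = re x z - re y z.
Proof. by rewrite (reADl pid) reN. Qed.

Lemma reBr x y z : re x (y - z) = re x y - re x z.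
Proof. by rewrite !(reAC pid x) reB. Qed.

Lemma nrm_eq0 x : nrm x = 0 -> x = 0.
Proof. by move=> x0; apply/eqP; rewrite -normr_eq0 normE x0. Qed.

Lemma nrmBC x y : nrm (x - y) = nrm (y - x).
Proof. by rewrite -opprB [- _]scaleCN1 (seminormAZr pid) normrN1 mul1r. Qed.

Lemma closure_ortho (M : set H) z w :
  closure M z -> (forall m, M m -> re m w = 0) -> re z w = 0.
Proof.
move=> /closureP cz h.
(* Upper bounds for both [w] and [- w] give equality with 0. *)
suff h0 : forall v, (v = w \/ v = - w) -> re z v <= 0.
  apply/eqP; rewrite eq_le h0/=; last by left.
  have := h0 (- w) (or_intror erefl).
  by rewrite (reAC pid) reN oppr_le0 (reAC pid).
move=> v hv; apply: (le_eps0 (seminormA_ge0 id v)) => e e0.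
have [m Mm zm] := cz _ e0.
have -> : re z v = re (z - m) v.
  rewrite reB [re m v](_ : _ = 0) ?subr0//; case: hv => ->; first exact: h.
  by rewrite (reAC pid) reN (reAC pid) h ?oppr0.
rewrite (le_trans (CauchySchwarz_reA pid _ _))// mulrC.
by rewrite ler_wpM2l ?seminormA_ge0 ?ltW.
Qed.

(** Orthogonality to [M] extends to its closure, hence to [z] itself. This serves as the uniqueness
    half of orthogonal projection. *)
Lemma closure_ortho0 (M : set H) z :
  closure M z -> (forall m, M m -> re m z = 0) -> z = 0.
Proof.
move=> cz h; apply: nrm_eq0; apply/eqP; rewrite -sqrf_eq0 (sqr_seminormA pid).
by apply/eqP; exact: closure_ortho cz h.
Qed.

(** The real part at ['i *: m] is, up to sign, the imaginary part at [m]. *)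
Lemma inner_eq_re (M : set H) z w : (forall m a, M m -> M (a *: m)) ->
  (forall m, M m -> re m z = re m w) ->
  forall m, M m -> inner m z = inner m w.
Proof.
move=> MZ h m Mm; have := h _ Mm; have := h _ (MZ _ 'i Mm).
rewrite /reA /innerA !innerZl.
case: (inner m z) => a b; case: (inner m w) => c d /= h1 h2.
by congr Complex; lra.
Qed.

(** * Completeness and Riesz representation *)

Lemma complete_seq (u : nat -> H) :
  (forall e : R, 0 < e ->
     exists N, forall n, (N <= n)%N -> nrm (u N - u n) < e) ->
  exists z, forall e : R, 0 < e ->
     exists N, forall n, (N <= n)%N -> nrm (z - u n) < e.
Proof.
move=> cu.
have eE (e : R[i]) : 0 < e -> 0 < complex.Re e /\ e = (complex.Re e)%:C.
  by move=> e0; have er := RRe_real (gtr0_real e0); rewrite -ltcR er.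
have /cauchy_cvgP/cvg_ex[z uz] : cauchy (u @ \oo).
  apply: cauchy_exP => e /eE[e0 ->]; have [N uN] := cu _ e0.
  exists (u N), N => // n Nn; rewrite /= -ball_normE /= normE ltcR.
  exact: uN.
exists z => e e0; have /cvgrPdist_lt/(_ e%:C) := uz.
rewrite ltcR => /(_ e0)[N _ hN]; exists N => n Nn.
by rewrite -ltcR -normE; exact: hN.
Qed.

(* Riesz representation and orthogonal projection in one statement: the case
   [M = setT] gives T^*, the case of the range of A gives reduced solutions. *)
Lemma riesz_closure (M : set H) (g : H -> R) (c : R) :
  M 0 -> (forall x y, M x -> M y -> M (x + y)) ->
  (forall (r : R) x, M x -> M (r%:C *: x)) ->
  (forall x y, g (x + y) = g x + g y) ->
  (forall (r : R) x, g (r%:C *: x) = r * g x) ->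
  (forall x, g x <= c * nrm x) ->
  exists2 z, closure M z & forall m, M m -> g m = re m z.
Proof.
move=> M0 MD MZ gD gZ gc.
(* A minimizing sequence of [f] on [M] is Cauchy by the parallelogram law, and
   its limit represents [g]. *)
pose f x := re x x - 2 * g x.
(* With [t = nrm m], [f m >= t ^+ 2 - 2 * c * t = (t - c) ^+ 2 - c ^+ 2]. *)
have flb : lbound (f @` M) (- c ^+ 2).
  move=> _ [m Mm <-]; have := gc m; rewrite /f -(sqr_seminormA pid).
  move: (nrm m) => t ?; have : 0 <= (t - c) ^+ 2 by exact: sqr_ge0.
  rewrite sqrrB; lra.
have fne : f @` M !=set0 by exists (f 0), 0.
have If m : M m -> inf (f @` M) <= f m.
  by move=> Mm; apply: ge_inf; [exists (- c ^+ 2)|exists m].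
set I := inf _ in If.
have seq n : {m | M m & f m < I + n.+1%:R^-1}.
  apply/cid2; have [||_ [m Mm <-] lt] := @inf_adherent _ (f @` M) n.+1%:R^-1.
  - by rewrite invr_gt0.
  - by split=> //; exists (- c ^+ 2).
  - by exists m.
pose u n := s2val (seq n).
have Mu n : M (u n) by exact: s2valP (seq n).
have fu n : f (u n) < I + n.+1%:R^-1 by exact: s2valP' (seq n).
(* The left side is twice [f x + f y - 2 * f v] for the midpoint [v] of [x] and [y], and
   [I <= f v]. *)
have par x y : M x -> M y -> re (x - y) (x - y) <= 2 * (f x + f y - 2 * I).
  move=> Mx My; have := If _ (MZ 2^-1 _ (MD _ _ Mx My)).
  rewrite /f gZ gD scaleCN1 !(reADl pid, reADr, reAZl pid, reAZr pid).
  by rewrite (reAC pid y x); lra.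
have [|z uz] := @complete_seq u.
  (* [par] bounds the squared distance by twice the sum of two errors, each below [e ^+ 2 / 4]. *)
  move=> e e0; have [|N hN] := @invS_lt _ (e ^+ 2 / 4).
    by rewrite divr_gt0 ?exprn_gt0.
  exists N => n Nn.
  rewrite -(@ltr_pXn2r _ 2)// ?nnegrE ?seminormA_ge0 ?(ltW e0)//.
  rewrite (sqr_seminormA pid).
  have := par _ _ (Mu N) (Mu n); have := fu N; have := fu n.
  have := hN N (leqnn N); have := hN n Nn.
  move: (f (u n)) (f (u N)) (n.+1%:R^-1) (N.+1%:R^-1) (reA _ _ _).
  by move=> a b c1 d1 r; lra.
exists z.
  apply/closureP => e /uz[N /(_ N (leqnn N)) ?].
  by exists (u N).
move=> m Mm.
(* Moving from [u n] along [m] lowers [f] by at most [n.+1%:R^-1], for every step length [t]; the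
   discriminant then bounds the derivative of [f] at [u n] in the direction [m]. *)
have var n : (re m (u n) - g m) ^+ 2 <= n.+1%:R^-1 * re m m.
  apply: discriminant_le; first exact: reAx_ge0.
  move=> t; have := If _ (MD _ _ (Mu n) (MZ t _ Mm)); have := fu n.
  rewrite /f gD gZ !(reADl pid, reADr, reAZl pid, reAZr pid) (reAC pid (u n) m).
  move: (n.+1%:R^-1) (reA _ _ _) (reA _ _ _) (reA _ _ _) => d1 a b c1; lra.
suff : `|g m - re m z| <= 0 by rewrite normr_le0 subr_eq0 => /eqP.
apply: (@le_eps0 _ _ (nrm m + nrm m)); first by rewrite addr_ge0 ?seminormA_ge0.
move=> e e0; have [N1 h1] := uz _ e0.
have [|N2 h2] := @invS_lt _ (e ^+ 2); first by rewrite exprn_gt0.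
have := h1 _ (leq_maxl N1 N2); have := h2 _ (leq_maxr N1 N2).
set n := maxn N1 N2 => n2 n1.
have -> : g m - re m z = (g m - re m (u n)) + re m (u n - z).
  by rewrite reBr; ring.
rewrite (le_trans (ler_normD _ _))// mulrDl lerD//.
  rewrite -(@ler_pXn2r _ 2)// ?nnegrE ?mulr_ge0 ?seminormA_ge0 ?(ltW e0)//.
  rewrite real_normK ?num_real// -sqrrN opprB (le_trans (var n))//.
  by rewrite exprMn (sqr_seminormA pid) mulrC ler_wpM2l ?reAx_ge0// ltW.
have cs v : re m v <= nrm m * nrm v by exact: CauchySchwarz_reA.
have : nrm m * nrm (u n - z) <= nrm m * e.
  by rewrite ler_wpM2l ?seminormA_ge0// nrmBC ltW.
rewrite ler_norml; have := cs (u n - z); have := cs (z - u n).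
rewrite (nrmBC z) -(opprB (u n)) !(reAC pid m) reN; lra.
Qed.

(** * Bounded operators and the Hilbert space adjoint *)

Lemma bounded_comp T S :
  bounded_operator T -> bounded_operator S -> bounded_operator (T \o S).
Proof.
move=> bT bS; have [lT _] := bT; have [lS _] := bS.
have /(boundedP lT)[c hc] := bT; have /(boundedP lS)[d hd] := bS.
have lTS : linear (T \o S) by move=> a x y /=; rewrite lS lT.
apply/(boundedP lTS); exists (`|c| * d) => x /=.
rewrite (le_trans (hc _))// (@le_trans _ _ (`|c| * nrm (S x)))//.
  by rewrite ler_wpM2r ?seminormA_ge0 ?ler_norm.
by rewrite -mulrA ler_wpM2l.
Qed.

Lemma bounded_add T S :
  bounded_operator T -> bounded_operator S -> bounded_operator (T \+ S).
Proof.
move=> [lT [c hc]] [lS [d hd]]; split.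
  by move=> a x y /=; rewrite lS lT scalerDr addrACA.
exists (c + d) => x /=.
by rewrite (le_trans (ler_normD _ _))// rmorphD mulrDl lerD.
Qed.

Lemma inner_inj y z : (forall x, inner x y = inner x z) -> y = z.
Proof.
move=> h; apply/eqP; rewrite -subr_eq0; apply/eqP/nrm_eq0/eqP.
rewrite -sqrf_eq0 (sqr_seminormA pid) reBr.
by rewrite /reA /innerA h subrr.
Qed.

Lemma adjointP T : bounded_operator T -> is_adjoint T (adjoint T).
Proof.
move=> bT; suff [S hS] : exists S, is_adjoint T S.
  exact: (xgetPex _ (ex_intro _ S hS)).
have [lT _] := bT; have /(boundedP lT)[c hc] := bT.
have ex y : {z | forall x, inner (T x) y = inner x z}.
  apply: cid.
  have [|||||x|z _ hz] :=
    @riesz_closure setT (fun x => re (T x) y) (c * nrm y) => //.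
  - by move=> x x'; rewrite lin_add// (reADl pid).
  - by move=> r x; rewrite lin_scale// (reAZl pid).
  - rewrite (le_trans (CauchySchwarz_reA pid _ _))//.
    by rewrite mulrAC ler_wpM2r ?seminormA_ge0.
  (* The representation holds for real parts; testing it at ['i *: x] recovers the imaginary
     parts. *)
  exists z => x; have := hz ('i *: x) I; have := hz x I.
  rewrite lin_scale// /reA /innerA !innerZl.
  case: (inner (T x) y) => a b; case: (inner x z) => a' b' /= h1 h2.
  by congr Complex; lra.
pose S y := sval (ex y).
have hS x y : inner (T x) y = inner x (S y) by exact: (svalP (ex y)).
have lS : linear S.
  by move=> a y z; apply: inner_inj => x; rewrite -hS !innerDr !innerZr !hS.
exists S; split=> //; apply/(boundedP lS); exists `|c| => y.
(* The square is the real part of [inner (T (S y)) y]; the factor [nrm (S y)] is cancelled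
   afterwards, unless it is 0. *)
have : nrm (S y) ^+ 2 <= nrm (S y) * (`|c| * nrm y).
  rewrite (sqr_seminormA pid) {1}/reA /innerA -hS.
  rewrite (le_trans (CauchySchwarz_reA pid _ _))// mulrA.
  rewrite ler_wpM2r ?seminormA_ge0//.
  rewrite (le_trans (hc _))// mulrC ler_wpM2l ?seminormA_ge0//.
  exact: ler_norm.
rewrite expr2; have : 0 <= nrm (S y) by exact: seminormA_ge0.
rewrite le_eqVlt => /predU1P[<- _|S0]; last by rewrite ler_pM2l.
by rewrite mulr_ge0 ?seminormA_ge0.
Qed.

(** * Adjoints with respect to [A] and reduced solutions *)

Section pair.
Variables (A : H -> H) (pA : positive_operator A).
Let lA := positive_linear pA.

Lemma inner_selfadjoint x y : inner (A x) y = inner x (A y).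
Proof. by rewrite (innerC x); exact: innerAC. Qed.

(** The operator equation is tested against all vectors, using that [A] is selfadjoint. This weak
    form is the one used in the estimates. *)
Lemma is_A_adjointP T X : bounded_operator T -> bounded_operator X ->
  is_A_adjoint A T X <-> forall x y, innerA A (T x) y = innerA A x (X y).
Proof.
move=> bT bX; have [_ hT] := adjointP bT; split=> [[_ AX] x y|h].
  rewrite /innerA !inner_selfadjoint hT.
  by have /(congr1 (fun f => f y)) /= -> := AX.
split=> //; apply/funext => y /=; apply: inner_inj => x.
by rewrite -hT -!inner_selfadjoint; exact: esym (h _ _).
Qed.

Lemma range_lin a x y : range A x -> range A y -> range A (a *: x + y).
Proof. by move=> [u _ <-] [v _ <-]; exists (a *: u + v); rewrite ?lA. Qed.

Lemma closure_range_lin a x y :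
  closure (range A) x -> closure (range A) y -> closure (range A) (a *: x + y).
Proof.
move=> /closureP cx /closureP cy; apply/closureP => e e0.
pose n := normc a; have n0 : 0 <= n := normc_ge0 a.
have [|u Au xu] := cx (e / (n + 1) / 2); first by rewrite !divr_gt0 ?ltr_wpDl.
have [|v Av yv] := cy (e / 2); first by rewrite divr_gt0.
exists (a *: u + v); first exact: range_lin.
have -> : a *: x + y - (a *: u + v) = a *: (x - u) + (y - v).
  by rewrite scalerBr opprD addrACA.
rewrite (le_lt_trans (seminormA_triangle pid _ _))// (seminormAZ pid) -/n.
have : n * nrm (x - u) <= (n + 1) * (e / (n + 1) / 2).
  by apply: ler_pM => //; rewrite ?seminormA_ge0 ?lerDl//; exact: ltW.
have -> : (n + 1) * (e / (n + 1) / 2) = e / 2.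
  by field; rewrite gt_eqF// ltr_wpDl.
lra.
Qed.

(** Project each [X x] orthogonally onto the closure of the range of [A]. The result [Y x] has the
    same inner products with that range, so [A \o Y = A \o X] because [A] is selfadjoint. *)
Lemma reduced_solution T X : is_A_adjoint A T X ->
  exists Y, is_A_adjoint A T Y /\ range Y `<=` closure (range A).
Proof.
move=> [bX AX]; have [lX _] := bX; have /(boundedP lX)[c hc] := bX.
have R0 : range A 0 by exists 0; rewrite ?lin_zero.
have RZ a x : range A x -> range A (a *: x).
  by move=> Ax; rewrite -[a *: x]addr0; exact: range_lin.
have ex x : {p | closure (range A) p /\
    forall m, range A m -> inner m (X x) = inner m p}.
  apply: cid.
  have [|||||y|p cp hp] :=
    @riesz_closure (range A) (fun m => re m (X x)) (nrm (X x)) => //.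
  - by move=> u v; rewrite -{2}[u]scale1r; exact: range_lin.
  - by move=> r u; exact: RZ.
  - by move=> u v; rewrite (reADl pid).
  - by move=> r u; rewrite (reAZl pid).
  - by rewrite mulrC; exact: CauchySchwarz_reA.
  by exists p; split=> //; apply: inner_eq_re => // m a; exact: RZ.
pose Y x := sval (ex x).
have cY x : closure (range A) (Y x) by exact: (svalP (ex x)).1.
have hY x m : range A m -> inner m (X x) = inner m (Y x).
  exact: (svalP (ex x)).2.
have lY : linear Y.
  (* The defect of linearity lies in the closure of the range and is orthogonal to the range, hence
     is 0. *)
  move=> a x y; apply/eqP; rewrite -subr_eq0; apply/eqP.
  apply: (@closure_ortho0 (range A)).
    rewrite [X in closure _ X]addrC -scaleN1r.
    by apply: closure_range_lin; [exact: closure_range_lin|exact: cY].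
  move=> m Am; rewrite reBr /reA /innerA innerDr innerZr.
  by rewrite -!hY// lX innerDr innerZr subrr.
exists Y; split; last by move=> _ [x _ <-].
split.
  apply/(boundedP lY); exists c => x; rewrite (le_trans _ (hc _))//.
  (* Projections do not increase the norm, so the constant [c] of [X] also serves for [Y]. *)
  have e : re (Y x) (Y x - X x) = 0.
    apply: (closure_ortho (cY x)) => m Am.
    by rewrite reBr /reA /innerA -hY// subrr.
  have : nrm (Y x) ^+ 2 <= nrm (Y x) * nrm (X x).
    rewrite (sqr_seminormA pid) (_ : re (Y x) (Y x) = re (Y x) (X x)).
      exact: CauchySchwarz_reA.
    by apply/eqP; rewrite -subr_eq0 -e reBr.
  rewrite expr2; have : 0 <= nrm (Y x) by exact: seminormA_ge0.
  by rewrite le_eqVlt => /predU1P[<- _|S0]; rewrite ?seminormA_ge0 ?ler_pM2l.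
rewrite -AX; apply/funext => y /=; apply: inner_inj => x.
by rewrite -!inner_selfadjoint hY//; exists x.
Qed.

(** A reduced solution exists, so [xget] returns an actual solution instead of its default. *)
Lemma sharpP T : has_A_adjoint A T -> bounded_operator (sharp A T) /\
  forall x y, innerA A (T x) y = innerA A x (sharp A T y).
Proof.
move=> [bT [X hX]]; have [Y hY] := reduced_solution hX.
have [h _] := xgetPex (fun=> 0) (ex_intro
  [set Z | is_A_adjoint A T Z /\ range Z `<=` closure (range A)] Y hY).
by split; [case: h|apply/is_A_adjointP => //; case: h].
Qed.

End pair.

(** * Boundedness in the seminorm of [A] *)

Section Abounded.
Variables (A : H -> H) (pA : positive_operator A).

Lemma selfadjoint_Abounded T : bounded_operator T ->
  (forall x y, innerA A (T x) y = innerA A x (T y)) ->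
  exists c : R, forall x, seminormA A x = 1 -> seminormA A (T x) <= c.
Proof.
move=> bT hT; have [lT _] := bT; have /(boundedP lT)[c0 hc0] := bT.
pose c := `|c0| + 1; have cp : 0 < c by rewrite ltr_wpDl.
have hc x : nrm (T x) <= c * nrm x.
  rewrite (le_trans (hc0 _))// ler_wpM2r ?seminormA_ge0// /c.
  by rewrite (le_trans (ler_norm _))// lerDl.
have bA : bounded_operator A := pA.1.
have /(boundedP (positive_linear pA))[k0 hk0] := bA.
(* Since [1 <= k], also [k0 <= k * k], which lets one constant bound the seminorm itself after
   taking square roots. *)
pose k := `|k0| + 1; have kp : 1 <= k by rewrite lerDr.
have hk x : seminormA A x <= k * nrm x.
  rewrite -(@ler_pXn2r _ 2)// ?nnegrE ?mulr_ge0 ?seminormA_ge0//; last lra.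
  rewrite (sqr_seminormA pA) -[reA A x x]/(re (A x) x).
  rewrite (le_trans (CauchySchwarz_reA pid _ _))//.
  rewrite (_ : (k * nrm x) ^+ 2 = k * k * nrm x * nrm x); last by ring.
  rewrite ler_wpM2r ?seminormA_ge0//.
  rewrite (le_trans (hk0 _))// ler_wpM2r ?seminormA_ge0//.
  have : k0 <= k by rewrite (le_trans (ler_norm _))// lerDl.
  have : k * 1 <= k * k by rewrite ler_pM2l//; lra.
  lra.
exists c => x x1; rewrite leNgt; apply/negP => cx.
have it n : nrm (iter n T x) <= c ^+ n * nrm x.
  elim: n => [|n IH]; first by rewrite mul1r.
  by rewrite iterS (le_trans (hc _))// exprS -mulrA ler_pM2l.
have sw n m y z :
    innerA A (iter n T y) (iter m T z) = innerA A y (iter (n + m) T z).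
  by elim: n m => //= n IH m; rewrite hT -iterS IH addnS.
(* For |x|_A = 1: |Tx|_A^(2^m) <= |T^(2^m) x|_A <= k c^(2^m) |x|, so the
   c-bound of T in the Hilbert norm is also an A-bound. *)
have sq n : seminormA A (iter n T x) ^+ 2 <= seminormA A (iter (n + n) T x).
  rewrite (sqr_seminormA pA) {1}/reA sw.
  by rewrite (le_trans (CauchySchwarz_reA pA _ _))// x1 mul1r.
have pw m : seminormA A (T x) ^+ (2 ^ m) <= seminormA A (iter (2 ^ m) T x).
  elim: m => [|m IH]; first by rewrite expn0 expr1.
  rewrite expnS mul2n -addnn exprD -expr2 (le_trans _ (sq _))//.
  by rewrite ler_pXn2r// ?nnegrE ?exprn_ge0 ?seminormA_ge0.
(* The powers of [1 + d], the ratio of [seminormA A (T x)] to [c], stay below [k * nrm x], while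
   Bernoulli's inequality makes them grow without bound. *)
pose d := seminormA A (T x) / c - 1.
have d0 : 0 < d by rewrite subr_gt0 ltr_pdivlMr// mul1r.
have bd m : (2 ^ m)%:R * d <= k * nrm x.
  have : 1 + (2 ^ m)%:R * d <= (1 + d) ^+ (2 ^ m) by rewrite exprn_ge_1D// ltW.
  suff : (1 + d) ^+ (2 ^ m) <= k * nrm x by lra.
  rewrite /d addrCA subrr addr0 exprMn exprVn ler_pdivrMr ?exprn_gt0//.
  rewrite (le_trans (pw _))// (le_trans (hk _))// -mulrA ler_wpM2l//; first lra.
  by rewrite mulrC.
have kn : 0 <= k * nrm x / d.
  by rewrite divr_ge0 ?mulr_ge0 ?seminormA_ge0 ?ltW//; lra.
(* An [m] above [k * nrm x / d] suffices, since [m < 2 ^ m]. *)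
have := archi_boundP kn; set m := Num.bound _ => hm.
have := bd m; rewrite leNgt => /negP; apply.
rewrite -ltr_pdivrMr// (lt_le_trans hm)// ler_nat ltnW//.
exact: ltn_expl.
Qed.

Lemma adjoint_pairC T X : (forall x y, innerA A (T x) y = innerA A x (X y)) ->
  forall x y, innerA A (X x) y = innerA A x (T y).
Proof. by move=> h x y; rewrite (innerAC pA) -h -(innerAC pA). Qed.

(** The operator [X \o T] is selfadjoint for [innerA A], and on the unit sphere the square of
    [seminormA A (T x)] is at most [seminormA A (X (T x))]. The square is removed by
    [2 * t <= 1 + t ^+ 2]. *)
Lemma adjoint_pair_Abounded T X : bounded_operator T -> bounded_operator X ->
  (forall x y, innerA A (T x) y = innerA A x (X y)) ->
  exists c : R, forall x, seminormA A x = 1 -> seminormA A (T x) <= c.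
Proof.
move=> bT bX h; have hC := adjoint_pairC h.
have [|c hc] := @selfadjoint_Abounded (X \o T) (bounded_comp bX bT).
  by move=> x y /=; rewrite hC h.
exists (1 + c) => x x1; have := hc _ x1.
have := CauchySchwarz_reA pA x ((X \o T) x).
rewrite x1 mul1r {1}/reA /= -h -/(reA _ _ _) -(sqr_seminormA pA).
have : 0 <= (seminormA A (T x) - 1) ^+ 2 by exact: sqr_ge0.
rewrite sqrrB1; have := seminormA_ge0 A (T x); lra.
Qed.

(** Twice the product equals [innerA A x y + innerA A r y], where the reflection [r] has the
    seminorm of [x]; Cauchy-Schwarz bounds the second term. *)
Lemma buzano x y e : seminormA A e = 1 ->
  2 * normc (innerA A x e * innerA A e y)
    <= normc (innerA A x y) + seminormA A x * seminormA A y.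
Proof.
move=> e1; set a := innerA A x e.
have ee : innerA A e e = 1.
  by rewrite (innerAE pA) -(sqr_seminormA pA) e1 expr1n.
(* [r] is the reflection of [x] in the line spanned by [e]. *)
pose r := (2 * a) *: e + (-1) *: x.
have -> : 2 * normc (a * innerA A e y) = normc (innerA A x y + innerA A r y).
  rewrite /r (innerADl pA) !(innerAZl pA) mulN1r addrCA subrr addr0 -mulrA.
  have E : 2 = 2%:C :> R[i] by rewrite rmorph_nat.
  by rewrite [in RHS]E normcZ ger0_norm.
rewrite (le_trans (le_normcD _ _))// lerD2l.
suff -> : seminormA A x = seminormA A r by exact: (CauchySchwarz_normc pA).
apply/eqP; rewrite -(@eqrXn2 _ 2)// ?seminormA_ge0// !(sqr_seminormA pA) /reA.
apply/eqP; congr complex.Re.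
rewrite /r !(innerADl pA, innerADr, innerAZl pA, innerAZr) ee.
rewrite (innerAC pA e x) -/a.
rewrite rmorphN rmorph1 rmorphM rmorph_nat; ring.
Qed.

(** * Suprema over the unit sphere of the seminorm *)

Lemma dwA_sqr_le T (B : R) : 0 <= B ->
  (forall x, seminormA A x = 1 ->
     normc (innerA A (T x) x) ^+ 2 + seminormA A (T x) ^+ 4 <= B) ->
  dwA A T ^+ 2 <= B.
Proof.
move=> B0 h; rewrite -[leRHS]sqr_sqrtr//.
rewrite ler_pXn2r ?nnegrE ?sqrtr_ge0//; last first.
  by apply: sup_nonneg_ge0 => _ [x _ <-]; exact: sqrtr_ge0.
rewrite /dwA; set E := image _ _.
(* An empty unit sphere gives [sup set0 = 0], where [0 <= Num.sqrt B] closes the case. *)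
have [->|/set0P E0] := eqVneq E set0; first by rewrite sup0 sqrtr_ge0.
apply: ge_sup => //.
by move=> _ [x x1 <-]; rewrite ler_wsqrtr// h.
Qed.

Lemma opnormA_ge0 T : 0 <= opnormA A T.
Proof. by apply: sup_nonneg_ge0 => _ [x _ <-]; exact: seminormA_ge0. Qed.

Lemma numradA_ge0 T : 0 <= numradA A T.
Proof. by apply: sup_nonneg_ge0 => _ [x _ <-]; exact: normc_ge0. Qed.

Section bounds.
Variables (T X : H -> H) (bT : bounded_operator T) (bX : bounded_operator X).
Hypothesis h : forall x y, innerA A (T x) y = innerA A x (X y).

Lemma opnormA_ub x : seminormA A x = 1 -> seminormA A (T x) <= opnormA A T.
Proof.
move=> x1; have [c hc] := adjoint_pair_Abounded bT bX h.
apply: ub_le_sup; last by exists x.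
by exists c => _ [y y1 <-]; exact: hc.
Qed.

Lemma numradA_ub x :
  seminormA A x = 1 -> normc (innerA A (T x) x) <= numradA A T.
Proof.
move=> x1; have [c hc] := adjoint_pair_Abounded bT bX h.
apply: ub_le_sup; last by exists x.
exists c => _ [y y1 <-].
rewrite (le_trans (CauchySchwarz_normc pA _ _))// y1 mulr1.
exact: hc.
Qed.

Lemma seminormA_le_opnormA x : seminormA A x != 0 ->
  seminormA A (T x) <= opnormA A T * seminormA A x.
Proof.
move=> x0; have [lT _] := bT.
have x_gt0 : 0 < seminormA A x by rewrite lt_def x0 seminormA_ge0.
have := @opnormA_ub ((seminormA A x)^-1%:C *: x).
rewrite lin_scale// !(seminormAZr pA) ger0_norm ?invr_ge0 ?(ltW x_gt0)//.
rewrite mulVf//.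
by move=> /(_ erefl); rewrite mulrC ler_pdivrMr.
Qed.

(** The square of [seminormA A (X x)] is at most [seminormA A (T (X x))], hence at most
    [opnormA A T * seminormA A (X x)]; cancel one factor. *)
Lemma seminormA_adjoint_le x :
  seminormA A x = 1 -> seminormA A (X x) <= opnormA A T.
Proof.
move=> x1; have [->|q0] := eqVneq (seminormA A (X x)) 0.
  exact: opnormA_ge0.
have q_gt0 : 0 < seminormA A (X x) by rewrite lt_def q0 seminormA_ge0.
rewrite -(ler_pM2r q_gt0) (le_trans _ (seminormA_le_opnormA q0))//.
rewrite -expr2 (sqr_seminormA pA) /reA (adjoint_pairC h).
by rewrite (le_trans (CauchySchwarz_reA pA _ _))// x1 mul1r.
Qed.

End bounds.
End Abounded.

(** * The two upper bounds for the Davis-Wielandt radius *)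

Lemma dwA_le_abs2A A T : positive_operator A -> has_A_adjoint A T ->
  dwA A T ^+ 2
    <= opnormA A (abs2A A T \+ (sharp A (abs2A A T) \o abs2A A T)).
Proof.
move=> pA hT; have [bX hX] := sharpP pA hT; have [bT _] := hT.
have hC := adjoint_pairC pA hX.
pose S := abs2A A T; rewrite -/S.
have bS : bounded_operator S by exact: bounded_comp.
have hS x y : innerA A (S x) y = innerA A x (S y).
  by rewrite /S /abs2A /= hC hX.
have [bS' hS'] : bounded_operator (sharp A S) /\
    forall x y, innerA A (S x) y = innerA A x (sharp A S y).
  (* [S] is its own [A]-adjoint, so [sharp A S] is a genuine reduced solution. *)
  by apply: sharpP => //; split=> //; exists S; apply/is_A_adjointP.
have hC' := adjoint_pairC pA hS'.
have bQ : bounded_operator (S \+ (sharp A S \o S)).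
  by apply: bounded_add => //; exact: bounded_comp.
(* Being selfadjoint for [innerA A], this operator is [A]-bounded, and its [opnormA] is a true upper
   bound on the unit sphere. *)
have hQ x y : innerA A ((S \+ (sharp A S \o S)) x) y
    = innerA A x ((S \+ (sharp A S \o S)) y).
  by rewrite /= (innerADl pA) innerADr hS hC' hS'.
apply: dwA_sqr_le => [|x x1]; first exact: opnormA_ge0.
apply: le_trans (opnormA_ub pA bQ bQ hQ x1).
rewrite (@le_trans _ _ (reA A ((S \+ (sharp A S \o S)) x) x))//; last first.
  by rewrite (le_trans (CauchySchwarz_reA pA _ _))// x1 mulr1.
rewrite /= (reADl pA) {2}/reA hC' -/(reA _ _ _) -(sqr_seminormA pA).
have TS : reA A (S x) x = seminormA A (T x) ^+ 2.
  by rewrite (sqr_seminormA pA) /reA /S /abs2A /= hC.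
have cs : seminormA A (T x) ^+ 2 <= seminormA A (S x).
  by rewrite -TS (le_trans (CauchySchwarz_reA pA _ _))// x1 mulr1.
rewrite TS lerD//.
  rewrite ler_pXn2r ?nnegrE ?seminormA_ge0 ?normc_ge0//.
  by rewrite (le_trans (CauchySchwarz_normc pA _ _))// x1 mulr1.
by rewrite (exprM _ 2 2) ler_pXn2r ?nnegrE ?exprn_ge0 ?seminormA_ge0.
Qed.

Lemma dwA_le_numradA A T : positive_operator A -> has_A_adjoint A T ->
  dwA A T ^+ 2
    <= 2^-1 * (numradA A (T \o T) + opnormA A T ^+ 2) + opnormA A T ^+ 4.
Proof.
move=> pA hT; have [bX hX] := sharpP pA hT; have [bT _] := hT.
set X := sharp A T in bX hX.
(* An adjoint for [T \o T] makes it [A]-bounded, so [numradA] bounds its values on the unit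
   sphere. *)
have hTT x y : innerA A ((T \o T) x) y = innerA A x ((X \o X) y).
  by rewrite /= !hX.
have nrm_ge0 := opnormA_ge0 A T.
apply: dwA_sqr_le => [|x x1].
  have := numradA_ge0 A (T \o T); have := exprn_ge0 4 nrm_ge0.
  have := exprn_ge0 2 nrm_ge0; lra.
have Tx := opnormA_ub pA bT bX hX x1.
rewrite lerD//; last by rewrite ler_pXn2r ?nnegrE ?seminormA_ge0.
(* Only one of the two equal factors is moved to [innerA A x (X x)]; Buzano's inequality then
   applies with [e = x]. *)
rewrite mulrC ler_pdivlMr// expr2 -ComplexField.Normc.normcM {2}hX mulrC.
rewrite (le_trans (buzano pA _ _ x1))// lerD//.
  rewrite -hX.
  exact: (numradA_ub pA (bounded_comp bT bT) (bounded_comp bX bX) hTT x1).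
by rewrite expr2 ler_pM ?seminormA_ge0// (seminormA_adjoint_le pA bT bX hX).
Qed.

End hilbert.

Theorem theorem2p13 (R : realType) (H : hilbertType R) (A T : H -> H)
    (hA : positive_operator A) (hT : has_A_adjoint A T) :
  dwA A T ^+ 2
    <= opnormA A (abs2A A T \+ (sharp A (abs2A A T) \o abs2A A T))
  /\
  dwA A T ^+ 2
    <= 2^-1 * (numradA A (T \o T) + opnormA A T ^+ 2) + opnormA A T ^+ 4.
Proof. by split; [exact: dwA_le_abs2A|exact: dwA_le_numradA]. Qed.
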